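(* For any path $\omega\in\Omega$, the set $\mathcal{I}_{\mathrm{C}}(\omega)$ of all interval forecasts that make $\omega$ computably random is closed under (finite) intersections: for any two interval forecasts $I$ and $J$ in $\mathcal{I}_{\mathrm{C}}(\omega)$, we have that $I\cap J\in\mathcal{I}_{\mathrm{C}}(\omega)$ (in particular, $I\cap J\neq\emptyset$).
   Context: Notation: $\mathbb{N}=\{1,2,\dots\}$, $\mathbb{N}_0=\mathbb{N}\cup\{0\}$. Situations are the finite binary sequences $\mathbb{S}=\bigcup_{n\in\mathbb{N}_0}\{0,1\}^n$, with $\square$ the empty sequence; $sx$ is $s$ with $x\in\{0,1\}$ appended. Paths are elements $\omega$ of $\Omega=\{0,1\}^{\mathbb{N}}$; $\omega_{1:n}\in\mathbb{S}$ consists of the first $n$ entries. $\mathcal{I}$ is the set of non-empty closed subintervals of $[0,1]$ (interval forecasts). For $f\colon\{0,1\}\to\mathbb{R}$ and $I\in\mathcal{I}$, $\overline{E}_I(f)=\max_{p\in I}[pf(1)+(1-p)f(0)]$. A forecasting system is a map $\varphi\colon\mathbb{S}\to\mathcal{I}$. For $I\in\mathcal{I}$, the stationary forecasting system $\gamma_I$ is given by $\gamma_I(s)=I$ for all $s\in\mathbb{S}$. A real process is a map $F\colon\mathbb{S}\to\mathbb{R}$, with $\Delta F(s)(x)=F(sx)-F(s)$. A test process is a non-negative real process with $F(\square)=1$. A supermartingale for $\varphi$ is a real process $M$ with $\overline{E}_{\varphi(s)}(\Delta M(s))\le 0$ for all $s\in\mathbb{S}$; a test supermartingale for $\varphi$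 is a test process that is a supermartingale for $\varphi$. ''Recursive'' means computable by a Turing machine (countable sets such as $\mathbb{S}$ and $\mathbb{S}\times\mathbb{N}_0$ are identified with $\mathbb{N}_0$ by recursive bijections with recursive inverse). A real process $F$ is computable if there are a recursive family of rationals $r_{s,n}$ and a recursive map $e\colon\mathbb{S}\times\mathbb{N}_0\to\mathbb{N}_0$ such that $n\ge e(s,N)$ implies $|r_{s,n}-F(s)|\le 2^{-N}$. A path $\omega$ is computably random for $\varphi$ if $\sup_{n\in\mathbb{N}}T(\omega_{1:n})<\infty$ for every computable test supermartingale $T$ for $\varphi$. $\mathcal{I}_{\mathrm{C}}(\omega)=\{I\in\mathcal{I}:\omega\text{ is computably random for }\gamma_I\}$. *)

(* Defs.v *)
From HB Require Import structures.
From mathcomp Require Import all_boot all_order all_algebra.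
From mathcomp Require Import all_classical all_reals all_analysis.
From mathcomp Require Import zify lra.

Set Implicit Arguments.
Unset Strict Implicit.
Unset Printing Implicit Defensive.

Import Order.TTheory GRing.Theory Num.Theory.
Local Open Scope classical_set_scope.
Local Open Scope ring_scope.

(** * Turing machines and recursive maps *)

Inductive head_move := MoveLeft | Stay | MoveRight.

Definition offset (m : head_move) : int :=
  match m with MoveLeft => -1 | Stay => 0 | MoveRight => 1 end.

(* Deterministic machines with finitely many (at least one) two-way infinite
   tapes.  [tm_delta] maps a state and the scanned symbols to the next state
   and, for each tape, the symbol to write and the head move; the machine halts
   when [tm_delta] is [None]. *)
Record turing_machine := TuringMachine {
  tm_tapes : nat;
  tm_alphabet : finType;
  tm_blank : tm_alphabet;
  tm_mark : tm_alphabet;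
  tm_mark_neq_blank : tm_mark != tm_blank;
  tm_state : finType;
  tm_start : tm_state;
  tm_delta : tm_state -> {ffun 'I_tm_tapes.+1 -> tm_alphabet} ->
    option (tm_state * {ffun 'I_tm_tapes.+1 -> tm_alphabet * head_move})
}.

Section TuringMachines.
Variable M : turing_machine.

(* Cells are numbered relative to the head, which always scans cell 0. *)
Definition tape := int -> tm_alphabet M.

Definition act_tape (t : tape) (am : tm_alphabet M * head_move) : tape :=
  fun i => let j := i + offset am.2 in if j == 0 then am.1 else t j.

Definition config := (tm_state M * ('I_(tm_tapes M).+1 -> tape))%type.

Definition tm_next (c : config) : option config :=
  if tm_delta c.1 [ffun k => c.2 k 0] is Some (q, a)
  then Some (q, fun k => act_tape (c.2 k) (a k)) else None.

Definition tm_run (n : nat) (c : config) : option config :=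
  iter n (obind tm_next) (Some c).

Definition unary_tape (n : nat) : tape :=
  fun i => if (0 <= i) && (i < n%:Z) then tm_mark M else tm_blank M.

(* The number n is written in unary on the first tape, with the head on the
   leftmost mark; all the other tapes are blank. *)
Definition standard_tapes (n : nat) : 'I_(tm_tapes M).+1 -> tape :=
  fun k => unary_tape (if k == ord0 then n else 0%N).

(* As usual for unary machines, the output must be delivered in the same
   standard form as the input. *)
Definition tm_computes (f : nat -> nat) : Prop :=
  forall n, exists t q,
    tm_run t (tm_start M, standard_tapes n) = Some (q, standard_tapes (f n)) /\
    tm_next (q, standard_tapes (f n)) = None.

End TuringMachines.

Definition recursive (f : nat -> nat) : Prop :=
  exists M : turing_machine, tm_computes M f.

(** * Situations and paths *)

Definition situation := seq bool.

(* [omega i] is the (i+1)-st entry of the path. *)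
Definition binary_path := nat -> bool.

Definition prefix_path (omega : binary_path) (n : nat) : situation := mkseq omega n.

(* Bijective base-2 numeration: the bits 0, 1 are read as the digits 1, 2. *)
Definition code_situation (s : situation) : nat :=
  foldl (fun c (x : bool) => (c.*2 + x).+1) 0%N s.

Lemma code_situation_rcons (s : situation) (x : bool) :
  code_situation (rcons s x) = ((code_situation s).*2 + x).+1.
Proof. by rewrite /code_situation foldl_rcons. Qed.

Lemma code_situation_inj : injective code_situation.
Proof.
elim/last_ind => [|s x IH] t; case/lastP: t => [|t y];
  rewrite ?code_situation_rcons //.
move=> [] /eqP; rewrite ![(_.*2 + _)%N]addnC => /eqP exy.
have xy : x = y.
  by move/(congr1 odd): exy; rewrite !oddD !odd_double !addbF !oddb.
move: exy; rewrite xy => /addnI /double_inj /IH -> //.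
Qed.

Lemma code_situation_surj n : exists s, code_situation s = n.
Proof.
elim/ltn_ind: n => -[|n] IH; first by exists [::].
have [|s sE] := IH n./2; first by lia.
by exists (rcons s (odd n)); rewrite code_situation_rcons sE; lia.
Qed.

(* Cantor's pairing bijection. *)
Definition code_pair (m n : nat) : nat := ('C((m + n).+1, 2) + n)%N.

Lemma code_pair_inj m n m' n' :
  code_pair m n = code_pair m' n' -> (m, n) = (m', n').
Proof.
have tri k l : (k < l -> 'C(k.+1, 2) + k < 'C(l.+1, 2))%N.
  move=> kl; have: ('C(k.+2, 2) <= 'C(l.+1, 2))%N by apply: leq_bin2l.
  by rewrite (binS k.+1 1) bin1; lia.
rewrite /code_pair => e.
have := tri (m + n)%N (m' + n')%N; have := tri (m' + n')%N (m + n)%N.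
case: (ltngtP (m + n)%N (m' + n')%N) => [lt _ /(_ isT)|gt /(_ isT) + _|eq _ _].
- lia.
- lia.
- by move: e; rewrite eq => /addnI en; congr pair; lia.
Qed.

Lemma code_pair_surj k : exists m n, code_pair m n = k.
Proof.
elim: k => [|k [m [n <-]]]; first by exists 0%N, 0%N.
case: m => [|m].
  exists n.+1, 0%N; rewrite /code_pair !add0n !addn0.
  by rewrite (binS n.+1 1) bin1; lia.
by exists m, n.+1; rewrite /code_pair addSnnS addnS.
Qed.

Definition recursive_family (f : situation -> nat -> nat) : Prop :=
  exists2 g : nat -> nat, recursive g &
    forall s n, g (code_pair (code_situation s) n) = f s n.

Definition recursive_rational_family (r : situation -> nat -> rat) : Prop :=
  exists sg a b : situation -> nat -> nat,
    [/\ recursive_family sg, recursive_family a, recursive_family b,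
        forall s n, (0 < b s n)%N &
        forall s n, r s n = (-1) ^+ sg s n * (a s n)%:R / (b s n)%:R].

(** * Interval forecasts *)

Record interval_forecast (R : realType) := IntervalForecast {
  forecast_set :> set R;
  forecast_setP : exists p q : R, [/\ 0 <= p, p <= q, q <= 1 &
    forecast_set = `[p, q]%classic]
}.

Section Forecasting.
Variable R : realType.
Implicit Types (I : interval_forecast R) (f : bool -> R).

(* The supremum is a maximum, see [upper_expectation_max]. *)
Definition upper_expectation I f : R :=
  sup [set p * f true + (1 - p) * f false | p in (I : set R)].

Lemma upper_expectation_max I f :
  (exists2 p, (I : set R) p &
    upper_expectation I f = p * f true + (1 - p) * f false) /\
  (forall p, (I : set R) p ->
    p * f true + (1 - p) * f false <= upper_expectation I f).
Proof.
pose g p : R := p * f true + (1 - p) * f false.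
suff [p Ip pmax] : exists2 p, (I : set R) p &
    forall q, (I : set R) q -> g q <= g p.
  have E : upper_expectation I f = g p.
    apply/eqP; rewrite eq_le; apply/andP; split.
      by apply: ge_sup => [|_ [q Iq <-]]; [exists (g p), p | exact: pmax].
    apply: ub_le_sup; last by exists p.
    by exists (g p) => _ [q Iq <-]; exact: pmax.
  by split=> [|q Iq]; [exists p | rewrite E; exact: pmax].
have [a [b [_ ab _ ->]]] := forecast_setP I.
case: (leP (f false) (f true)) => fle.
  exists b => [|q] /=; rewrite in_itv /= ?ab ?lexx // => /andP[_ qb].
  by rewrite /g; nra.
exists a => [|q] /=; rewrite in_itv /= ?ab ?lexx // => /andP[aq _].
by rewrite /g; nra.
Qed.

Definition forecasting_system := situation -> interval_forecast R.

Definition stationary I : forecasting_system := fun=> I.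

(** * Processes and computable randomness *)

Definition real_process := situation -> R.

Definition increment (F : real_process) (s : situation) (x : bool) : R :=
  F (rcons s x) - F s.

Definition test_process (F : real_process) : Prop :=
  (forall s, 0 <= F s) /\ F [::] = 1.

Definition supermartingale (phi : forecasting_system) (M : real_process) :=
  forall s, upper_expectation (phi s) (increment M s) <= 0.

Definition test_supermartingale (phi : forecasting_system) (T : real_process) :=
  test_process T /\ supermartingale phi T.

Definition computable_process (F : real_process) : Prop :=
  exists (r : situation -> nat -> rat) (e : situation -> nat -> nat),
    [/\ recursive_rational_family r, recursive_family e &
        forall s N n, (e s N <= n)%N -> `|ratr (r s n) - F s| <= 2 ^- N].

Definition computably_random (phi : forecasting_system) (omega : binary_path) :=
  forall T : real_process, computable_process T -> test_supermartingale phi T ->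
    (ereal_sup [set (T (prefix_path omega n))%:E | n in [set n | (0 < n)%N]]
       < +oo)%E.

Definition computably_random_forecasts (omega : binary_path) :
    set (interval_forecast R) :=
  [set I | computably_random (stationary I) omega].

End Forecasting.

(* Main.v *)
Require Import Defs.
From mathcomp Require Import all_boot all_order all_algebra.
From mathcomp Require Import all_classical all_reals all_analysis.
From mathcomp Require Import zify ring lra.

Set Implicit Arguments.
Unset Strict Implicit.
Unset Printing Implicit Defensive.

Import Order.TTheory GRing.Theory Num.Theory.
Local Open Scope classical_set_scope.
Local Open Scope ring_scope.

(* If the forecasts lay on either side of a gap, two parallel bets against the
   frequencies of ones would have an exponentially growing product of capitals,
   so one of them would be unbounded; hence the forecasts overlap.  Let now [T]
   be a computable test supermartingale for the intersection [[c, d]].  It is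
   dominated by a positive supermartingale [Q] with recursive rational values,
   and [Q] is a constant times the product of two processes: one follows the
   relative changes of [Q] where [Q] gains more on a one than on a zero, and is
   otherwise constant, the other one does the opposite.  The supermartingale
   inequality of the first process is tightest at the largest probability of a
   one, so it holds for the forecast with upper end [d]; symmetrically, the
   second process is a supermartingale for the forecast with lower end [c].
   Both are therefore bounded along the path, and so is [T].  Their
   computability comes from compiling counter programs with oracle calls to
   Turing machines. *)

(** * Multi-tape machines *)

Section Machines.
Variables (S : finType) (blank mark : S) (mark_neq_blank : mark != blank).
Variable n : nat.

Definition tapes := 'I_n.+1 -> int -> S.

Definition act (t : int -> S) (am : S * head_move) : int -> S :=
  fun i => let j := i + offset am.2 in if j == 0 then am.1 else t j.

Definition act_all (t : tapes) (a : {ffun 'I_n.+1 -> S * head_move}) : tapes :=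
  fun k => act (t k) (a k).

Definition scan (t : tapes) : {ffun 'I_n.+1 -> S} := [ffun k => t k 0].

Definition transition (Q : finType) :=
  Q -> {ffun 'I_n.+1 -> S} -> option (Q * {ffun 'I_n.+1 -> S * head_move}).

Inductive runs (Q : finType) (d : transition Q) :
    Q -> tapes -> tapes -> Prop :=
| runs_halt q t : d q (scan t) = None -> runs d q t t
| runs_step q t q' a t' : d q (scan t) = Some (q', a) ->
    runs d q' (act_all t a) t' -> runs d q t t'.

(** [P] is a partial specification: only tapes that [P] relates to something constrain the machine,
    so preconditions such as being an encoding are put into [P]. *)
Definition realizable (P : tapes -> tapes -> Prop) : Prop :=
  exists (Q : finType) (q : Q) (d : transition Q),
    forall t t', P t t' -> runs d q t t'.

Definition idle (s : {ffun 'I_n.+1 -> S}) : {ffun 'I_n.+1 -> S * head_move} :=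
  [ffun k => (s k, Stay)].

Lemma act_idle t : act_all t (idle (scan t)) = t.
Proof.
apply/funext => k; apply/funext => i; rewrite /act_all /act !ffunE /= addr0.
by case: eqP => [->|].
Qed.

Lemma runs_idle (Q : finType) (d : transition Q) q q' t t' :
  d q (scan t) = Some (q', idle (scan t)) -> runs d q' t t' -> runs d q t t'.
Proof. by move=> dq; rewrite -{1}(act_idle t); exact: runs_step. Qed.

(** Embeds the run of a component into a composite machine: non-halting steps are copied, and where
    the component halts the composite takes over. *)
Lemma runs_lift (Q Q' : finType) (d : transition Q) (d' : transition Q')
    (h : Q -> Q') t' t'' :
  (forall q s q' a, d q s = Some (q', a) -> d' (h q) s = Some (h q', a)) ->
  (forall q, d q (scan t') = None -> runs d' (h q) t' t'') ->
  forall q t, runs d q t t' -> runs d' (h q) t t''.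
Proof.
move=> hstep hhalt q t r; elim: r hhalt => {q t t'} [q t dq hhalt|]; first exact: hhalt.
by move=> q t q' a t' dq _ IH hhalt; apply: runs_step (hstep _ _ _ _ dq) (IH hhalt).
Qed.

Lemma realizable_seq P P' : realizable P -> realizable P' ->
  realizable (fun t t' => exists2 t1, P t t1 & P' t1 t').
Proof.
move=> [Q [q [d Pd]]] [Q' [q' [d' Pd']]].
pose D : transition (Q + Q')%type := fun x s =>
  match x with
  | inl p => if d p s is Some (p1, a) then Some (inl p1, a)
             else Some (inr q', idle s)
  | inr p => if d' p s is Some (p1, a) then Some (inr p1, a) else None
  end.
exists (Q + Q')%type, (inl q), D => t t' [t1 /Pd r1 /Pd' r2].
apply: (runs_lift (h := inl)) r1 => [p s p1 a /= -> //|p dp].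
apply: (@runs_idle _ _ _ (inr q')); first by rewrite /= dp.
by apply: (runs_lift (h := inr)) r2 => [p' s p1 a /= -> //|p' dp']; constructor; rewrite /= dp'.
Qed.

Lemma realizable_if (b : {ffun 'I_n.+1 -> S} -> bool) P P' :
  realizable P -> realizable P' ->
  realizable (fun t t' => if b (scan t) then P t t' else P' t t').
Proof.
move=> [Q [q [d Pd]]] [Q' [q' [d' Pd']]].
pose D : transition (option (Q + Q'))%type := fun x s =>
  match x with
  | None => Some (if b s then Some (inl q) else Some (inr q'), idle s)
  | Some (inl p) => if d p s is Some (p1, a) then Some (Some (inl p1), a) else None
  | Some (inr p) => if d' p s is Some (p1, a) then Some (Some (inr p1), a) else None
  end.
exists (option (Q + Q'))%type, None, D => t t' Ptt'.
apply: runs_idle; first by [].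
case: ifP Ptt' => _ => [/Pd r|/Pd' r].
  by apply: (runs_lift (h := Some \o inl)) r => [p s p1 a /= -> //|p dp]; constructor; rewrite /= dp.
by apply: (runs_lift (h := Some \o inr)) r => [p s p1 a /= -> //|p dp]; constructor; rewrite /= dp.
Qed.

Inductive loop (T : Type) (b : T -> bool) (P : T -> T -> Prop) : T -> T -> Prop :=
| loop_stop t : ~~ b t -> loop b P t t
| loop_next t t1 t' : b t -> P t t1 -> loop b P t1 t' -> loop b P t t'.

Lemma realizable_loop (b : {ffun 'I_n.+1 -> S} -> bool) P :
  realizable P -> realizable (loop (b \o scan) P).
Proof.
move=> [Q [q [d Pd]]].
pose D : transition (option Q)%type := fun x s =>
  match x with
  | None => if b s then Some (Some q, idle s) else None
  | Some p => if d p s is Some (p1, a) then Some (Some p1, a)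
              else Some (None, idle s)
  end.
exists (option Q), None, D => t t'; elim=> {t t'} [t /negPf bt|t t1 t' bt /Pd r _ IH].
  by constructor; rewrite /= -/(scan t) [b _]bt.
apply: (@runs_idle _ _ _ (Some q)); first by rewrite /= [b _]bt.
apply: (runs_lift (h := Some)) r => [p s p1 a /= -> //|p dp].
by apply: runs_idle IH; rewrite /= dp.
Qed.

Lemma realizable_act (a : {ffun 'I_n.+1 -> S} -> {ffun 'I_n.+1 -> S * head_move}) :
  realizable (fun t t' => t' = act_all t (a (scan t))).
Proof.
pose d : transition bool := fun q s => if q then Some (false, a s) else None.
exists bool, true, d => t _ ->; apply: runs_step; first by [].
exact: runs_halt.
Qed.

Lemma realizable_weaken P P' : (forall t t', P' t t' -> P t t') ->
  realizable P -> realizable P'.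
Proof. by move=> PP' [Q [q [d Pd]]]; exists Q, q, d => t t' /PP'/Pd. Qed.

Definition unary (m : nat) : int -> S :=
  fun i => if (0 <= i) && (i < m%:Z) then mark else blank.

(* Tapes 0 to 4 are registers; the other tapes are scratch space for calls and
   are blank between instructions. *)
Definition encode (w : seq nat) : tapes :=
  fun k => unary (if (k <= 4)%N then nth 0%N w k else 0%N).

Hypothesis n_ge4 : (4 <= n)%N.

Lemma unary0 m : (unary m 0 == mark) = (0 < m)%N.
Proof.
rewrite /unary lexx /= ltz_nat; case: ifP => _; first by rewrite eqxx.
by rewrite eq_sym (negPf mark_neq_blank).
Qed.

Lemma scan_encode w i : (i <= 4)%N ->
  (scan (encode w) (inord i) == mark) = (0 < nth 0%N w i)%N.
Proof.
by move=> i4; rewrite ffunE unary0 inordK ?i4 //; apply: leq_trans (n_ge4).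
Qed.

Lemma realizable_inc i : (i <= 4)%N ->
  realizable (fun t t' => exists2 w, t = encode w & t' = encode (incr_nth w i)).
Proof.
move=> i4; have i_n : (i < n.+1)%N by apply: leq_trans n_ge4.
(* A transition writes before it moves. A unary number grows at its left end, so the head first
   moves left and only a second transition writes the new leftmost mark. *)
pose left (s : {ffun 'I_n.+1 -> S}) :=
  [ffun k => (s k, if k == inord i then MoveLeft else Stay)].
pose write (s : {ffun 'I_n.+1 -> S}) :=
  [ffun k => (if k == inord i then mark else s k, Stay)].
apply: realizable_weaken (realizable_seq (realizable_act left) (realizable_act write)).
move=> _ _ [w -> ->]; eexists; first by [].
apply/funext => k; apply/funext => z; rewrite /act_all /act !ffunE /= !addr0.
have [->|ki] := eqVneq k (inord i).
  rewrite /encode inordK // i4 nth_incr_nth eqxx add1n /unary /offset.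
  have [->|z0] := eqVneq z 0; first by [].
  have -> : (z + -1 == 0) = (z == 1) by lia.
  have [->|z1] := eqVneq z 1; first by rewrite !ltz_nat lexx; case: nth.
  by congr (if _ then _ else _); lia.
rewrite /encode nth_incr_nth.
have -> : (i == k :> nat) = false.
  by apply: contraNF ki => /eqP ik; rewrite -val_eqE /= inordK ?ik.
by rewrite !addr0; case: eqP => [->|].
Qed.

Lemma realizable_dec i : (i <= 4)%N ->
  realizable (fun t t' => exists2 w,
    t = encode w & t' = encode (set_nth 0%N w i (nth 0%N w i).-1)).
Proof.
move=> i4; have i_n : (i < n.+1)%N by apply: leq_trans n_ge4.
(* The test for a mark leaves a zero register alone, in agreement with [0.-1 = 0]. *)
pose erase (s : {ffun 'I_n.+1 -> S}) :=
  [ffun k => if (k == inord i) && (s k == mark) then (blank, MoveRight) else (s k, Stay)].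
apply: realizable_weaken (realizable_act erase).
move=> _ _ [w -> ->]; apply/funext => k; apply/funext => z; rewrite /act_all /act !ffunE /=.
have [->|ki] := eqVneq k (inord i).
  rewrite /encode inordK // i4 unary0 nth_set_nth /= eqxx /unary.
  case: (nth 0%N w i) => [|m] /=.
    by rewrite addr0; case: eqP => [->|].
  have [z1|z1] := eqVneq (z + 1) 0; first by rewrite (_ : z = -1) //; lia.
  by congr (if _ then _ else _); lia.
rewrite /encode nth_set_nth /=.
have -> : (k == i :> nat) = false.
  by apply: contraNF ki => /eqP ik; rewrite -val_eqE /= inordK ?ik.
by rewrite /= addr0; case: eqP => [->|].
Qed.

End Machines.

(** * Calling a machine as a subroutine *)

Section Call.
Variables (S : finType) (blank mark : S) (n : nat).
Variables (M : turing_machine) (f : nat -> nat) (Mf : tm_computes M f).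
Hypothesis n_large : (4 + tm_tapes M <= n)%N.
Variables (en : tm_alphabet M -> S) (de : S -> tm_alphabet M).
Hypotheses (enK : cancel en de) (en_blank : en (tm_blank M) = blank)
  (en_mark : en (tm_mark M) = mark).

(** Tape 0 of [M] is register 0 and its other tapes start at scratch tape 5, so registers 1 to 4
    survive a call. *)
Let tape_of (j : 'I_(tm_tapes M).+1) : 'I_n.+1 :=
  inord (if j == 0%N :> nat then 0%N else j + 4)%N.

Lemma tape_ofE j : tape_of j = (if j == 0%N :> nat then 0%N else j + 4)%N :> nat.
Proof. by rewrite inordK //; case: ifP => // _; have := ltn_ord j; lia. Qed.

Lemma tape_of_inj : injective tape_of.
Proof.
move=> j k /(congr1 val) /=; rewrite !tape_ofE => e; apply: val_inj => /=.
by move: e; case: eqP => [->|?]; case: eqP => [->|?] //; lia.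
Qed.

Let embed (t0 : tapes S n) (u : 'I_(tm_tapes M).+1 -> tape M) : tapes S n :=
  fun k => if [pick j | tape_of j == k] is Some j then en \o u j else t0 k.

Lemma embed_tape_of t0 u j : embed t0 u (tape_of j) = en \o u j.
Proof.
rewrite /embed; case: pickP => [k /eqP/tape_of_inj -> //|/(_ j)].
by rewrite eqxx.
Qed.

Let call_delta : transition S n (tm_state M) := fun q s =>
  if tm_delta q [ffun j => de (s (tape_of j))] is Some (q', a)
  then Some (q', [ffun k => if [pick j | tape_of j == k] is Some j
                            then (en (a j).1, (a j).2) else (s k, Stay)])
  else None.

Lemma scan_embed t0 u :
  [ffun j => de (scan (embed t0 u) (tape_of j))] = [ffun j => u j 0].
Proof. by apply/ffunP => j; rewrite !ffunE embed_tape_of /= enK. Qed.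

Lemma runs_embed t0 m q u q' u' :
  tm_run m (q, u) = Some (q', u') -> tm_next (q', u') = None ->
  runs call_delta q (embed t0 u) (embed t0 u').
Proof.
elim: m q u => [|m IH] q u.
  move=> [-> ->]; rewrite /tm_next /= => halt; constructor.
  by rewrite /call_delta scan_embed; move: halt; case: tm_delta => [[]|].
rewrite /tm_run iterSr /= /tm_next /=.
case E: tm_delta => [[q1 a]|] r halt; last first.
  by move: r; have -> : iter m (obind (tm_next (M := M))) None = None by elim: m {IH} => //= m ->.
apply: (@runs_step _ _ _ _ _ _ q1); first by rewrite /call_delta scan_embed E.
have := IH q1 (fun k => act_tape (u k) (a k)) r halt.
set t1 := embed t0 _; set t2 := act_all _ _; suff -> : t1 = t2 by [].
apply/funext => k; apply/funext => z.
rewrite /t1 /t2 /act_all /act /embed !ffunE.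
case: pickP => [j /= _|_]; first by rewrite /act_tape /=; case: eqP.
by rewrite /= addr0; case: eqP => [->|].
Qed.

(** Because [M] halts in standard form, its scratch tapes are blank again and register 0 is again an
    encoding; calls can therefore be repeated. *)
Lemma realizable_call :
  realizable (fun t t' => exists2 w, t = encode blank mark (n := n) w &
    t' = encode blank mark (set_nth 0%N w 0 (f (nth 0%N w 0)))).
Proof.
exists (tm_state M), (tm_start M), call_delta => _ _ [w -> ->].
have [t [q [r halt]]] := Mf (nth 0%N w 0).
have := runs_embed (encode blank mark w) r halt.
suff E m : embed (encode blank mark w) (standard_tapes m) =
    encode blank mark (set_nth 0%N w 0 m).
  rewrite !E; congr (runs _ _ _ _); apply/funext => k.
  by rewrite /encode nth_set_nth /=; case: eqP => [->|].
apply/funext => k; apply/funext => z; rewrite /embed.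
have en_unary l : en (unary_tape M l z) = unary blank mark l z.
  by rewrite /unary_tape /unary; case: ifP.
case: pickP => [j /eqP <-|nok].
  rewrite /= /standard_tapes en_unary /encode tape_ofE nth_set_nth /= -val_eqE /=.
  by case: eqP => //= j0; rewrite leqNgt; case: ltnP => //; lia.
rewrite /encode nth_set_nth /=; case: eqP => // k0.
by have := nok ord0; rewrite -val_eqE /= tape_ofE /= k0.
Qed.

End Call.

(** * While programs over five counters, with two oracles *)

(** [Call] applies one of two oracles to counter 0, the boolean choosing which. Two oracles are what
    composition and pairing of recursive functions require. *)
Inductive prog :=
| Inc of nat | Dec of nat | Call of bool | Seq of prog & prog
| While of nat & prog | If of nat & prog & prog.

Fixpoint wf_prog (p : prog) : bool :=
  match p with
  | Inc i | Dec i => (i <= 4)%N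
  | Call _ => true
  | Seq p q => wf_prog p && wf_prog q
  | While i p => (i <= 4)%N && wf_prog p
  | If i p q => [&& (i <= 4)%N, wf_prog p & wf_prog q]
  end.

Section Exec.
Variables f g : nat -> nat.

Fixpoint exec (p : prog) : seq nat -> seq nat -> Prop :=
  match p with
  | Inc i => fun w w' => w' = incr_nth w i
  | Dec i => fun w w' => w' = set_nth 0%N w i (nth 0%N w i).-1
  | Call b => fun w w' =>
      w' = set_nth 0%N w 0 ((if b then f else g) (nth 0%N w 0))
  | Seq p q => fun w w' => exists2 w1, exec p w w1 & exec q w1 w'
  | While i p => loop (fun w => 0 < nth 0%N w i)%N (exec p)
  | If i p q => fun w w' =>
      if (0 < nth 0%N w i)%N then exec p w w' else exec q w w'
  end.

Lemma realizable_prog (S : finType) (blank mark : S) n p :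
  mark != blank -> (4 <= n)%N ->
  (forall b, realizable (n := n) (fun t t' => exists2 w,
     t = encode blank mark w & t' = encode blank mark
       (set_nth 0%N w 0 ((if b then f else g) (nth 0%N w 0))))) ->
  wf_prog p ->
  realizable (n := n) (fun t t' => exists w w', [/\ t = encode blank mark w,
    t' = encode blank mark w' & exec p w w']).
Proof.
move=> mb n4 call; elim: p => [i|i|b|p IHp q IHq|i p IHp|i p IHp q IHq] /=.
- move=> i4; apply: realizable_weaken (realizable_inc mb n4 i4).
  by move=> _ _ [w [w' [-> -> ->]]]; exists w.
- move=> i4; apply: realizable_weaken (realizable_dec mb n4 i4).
  by move=> _ _ [w [w' [-> -> ->]]]; exists w.
- move=> _; apply: realizable_weaken (call b).
  by move=> _ _ [w [w' [-> -> ->]]]; exists w.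
- move=> /andP[/IHp Rp /IHq Rq]; apply: realizable_weaken (realizable_seq Rp Rq).
  move=> _ _ [w [w' [-> -> [w1 ? ?]]]]; exists (encode blank mark w1).
    by exists w, w1.
  by exists w1, w'.
- move=> /andP[i4 /IHp Rp].
  apply: realizable_weaken (realizable_loop (fun s => s (inord i) == mark) Rp).
  move=> _ _ [w [w' [-> -> e]]]; elim: e => {w w'} [w w0|w w1 w' w0 e _ IH].
    by apply: loop_stop; rewrite /= scan_encode.
  by apply: loop_next IH; [rewrite /= scan_encode|exists w, w1].
- move=> /and3P[i4 /IHp Rp /IHq Rq].
  apply: realizable_weaken (realizable_if (fun s => s (inord i) == mark) Rp Rq).
  move=> _ _ [w [w' [-> -> e]]]; rewrite scan_encode //.
  by case: ifP e => _ e; exists w, w'.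
Qed.

Theorem recursive_prog p h : recursive f -> recursive g -> wf_prog p ->
  (forall m, exec p [:: m; 0; 0; 0; 0] [:: h m; 0; 0; 0; 0])%N -> recursive h.
Proof.
move=> [Mf compf] [Mg compg] wfp ph.
pose n := (4 + (tm_tapes Mf + tm_tapes Mg))%N.
(* Each oracle machine works in its own component of a symbol. The encodings below fill the other
   component so that blanks and marks of either machine become the common [blank] and [mark]. *)
pose S : finType := (tm_alphabet Mf * tm_alphabet Mg)%type.
pose blank : S := (tm_blank Mf, tm_blank Mg).
pose mark : S := (tm_mark Mf, tm_mark Mg).
have mb : mark != blank by rewrite xpair_eqE negb_and tm_mark_neq_blank.
have [] := @realizable_prog S blank mark n p mb (leq_addr _ _) _ wfp.
  case.
    pose en a : S := (a, if a == tm_mark Mf then tm_mark Mg else tm_blank Mg).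
    apply: (realizable_call compf _ (en := en) (de := fst)) => //; first by rewrite /n; lia.
      by rewrite /en eq_sym (negPf (tm_mark_neq_blank Mf)).
    by rewrite /en eqxx.
  pose en a : S := (if a == tm_mark Mg then tm_mark Mf else tm_blank Mf, a).
  apply: (realizable_call compg _ (en := en) (de := snd)) => //; first by rewrite /n; lia.
    by rewrite /en eq_sym (negPf (tm_mark_neq_blank Mg)).
  by rewrite /en eqxx.
move=> Q [q [d run]]; pose M := TuringMachine mb q d; exists M => m.
have std l : standard_tapes (M := M) l = encode blank mark [:: l; 0; 0; 0; 0]%N :> tapes S n.
  apply/funext => k; rewrite /standard_tapes /encode /unary_tape /unary -val_eqE /=.
  by case: (val k) => [|[|[|[|[|k']]]]].
have key q1 t t' : runs d q1 t t' -> exists l q', tm_run (M := M) l (q1, t) =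
    Some (q', t') /\ tm_next (M := M) (q', t') = None.
  elim=> {q1 t t'} [q1 t dq|q1 t q2 a t' dq _ [l [q3 [r halt]]]].
    by exists 0%N, q1; split=> //; rewrite /tm_next /=; move: dq; rewrite /scan => ->.
  exists l.+1, q3; split=> //; rewrite /tm_run iterSr /= {2}/tm_next /=.
  by move: dq; rewrite /scan => ->.
rewrite !std; apply: key; apply: run.
by exists [:: m; 0; 0; 0; 0]%N, [:: h m; 0; 0; 0; 0]%N.
Qed.

(** [W m] is the loop invariant, indexed by the value of the loop counter, which falls by one at
    each pass. *)
Lemma exec_while i p k (W : nat -> seq nat) :
  (forall m, (m <= k)%N -> nth 0%N (W m) i = m) ->
  (forall m, (m < k)%N -> exec p (W m.+1) (W m)) ->
  exec (While i p) (W k) (W 0%N).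
Proof.
move=> Wi; elim: k Wi => [|k IH] Wi pW; first by apply: loop_stop; rewrite Wi.
apply: loop_next (pW k _) (IH _ _) => //; first by rewrite Wi.
  by move=> m mk; apply: Wi; lia.
by move=> m mk; apply: pW; lia.
Qed.

End Exec.

(** * Closure properties of the recursive functions *)

Section Recursive.
Local Open Scope nat_scope.
Implicit Types f g : nat -> nat.

Definition move (i j : nat) : prog := While i (Seq (Dec i) (Inc j)).

Lemma exec_move f g i j w : i != j -> i < size w -> j < size w ->
  exec f g (move i j) w
    (set_nth 0 (set_nth 0 w j (nth 0 w j + nth 0 w i)) i 0).
Proof.
move=> ij iw jw.
pose W m := set_nth 0 (set_nth 0 w j (nth 0 w j + (nth 0 w i - m))) i m.
have sW m : size (W m) = size w by rewrite /W !size_set_nth; lia.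
have -> : set_nth 0 (set_nth 0 w j (nth 0 w j + nth 0 w i)) i 0 = W 0.
  by rewrite /W subn0.
have {1}-> : w = W (nth 0 w i).
  apply: (@eq_from_nth _ 0) => [|k _]; first by rewrite sW.
  rewrite /W !nth_set_nth /= nth_set_nth /= subnn addn0.
  by case: eqP => [->//|_]; case: eqP => [->|].
apply: exec_while => m mw; first by rewrite nth_set_nth /= eqxx.
exists (set_nth 0 (W m.+1) i m); first by rewrite /= {2}/W nth_set_nth /= eqxx.
apply: (@eq_from_nth _ 0) => [|k _].
  by rewrite size_incr_nth size_set_nth !sW; case: ifP => //; lia.
rewrite nth_incr_nth /W !nth_set_nth /= !nth_set_nth /= nth_set_nth /=.
by case: (eqVneq k i) ij => [->|ki] ij; case: (eqVneq k j); lia.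
Qed.

Lemma recursive_id : recursive id.
Proof.
pose M := @TuringMachine 0 bool false true isT unit tt (fun _ _ => None).
by exists M => n; exists 0, tt.
Qed.

Lemma recursive_comp f g : recursive f -> recursive g -> recursive (f \o g).
Proof.
move=> rf rg; apply: (@recursive_prog f g (Seq (Call false) (Call true))) => // m.
by eexists.
Qed.

Lemma recursive_succ : recursive succn.
Proof. by apply: (@recursive_prog id id (Inc 0) _ recursive_id recursive_id). Qed.

Lemma exec_clear f g i w : i < size w ->
  exec f g (While i (Dec i)) w (set_nth 0 w i 0).
Proof.
move=> iw; have {1}-> : w = set_nth 0 w i (nth 0 w i).
  apply: (@eq_from_nth _ 0) => [|k _]; first by rewrite size_set_nth; lia.
  by rewrite nth_set_nth /=; case: eqP => [->|].
apply: (@exec_while _ _ _ _ (nth 0 w i) (set_nth 0 w i)) => m _.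
  by rewrite nth_set_nth /= eqxx.
by rewrite /= nth_set_nth /= eqxx set_set_nth eqxx.
Qed.

Lemma recursive_cst c : recursive (fun=> c).
Proof.
elim: c => [|c IH]; last exact: recursive_comp recursive_succ IH.
apply: (@recursive_prog id id (While 0 (Dec 0)) _ recursive_id recursive_id) => // m.
exact: (@exec_clear _ _ 0 [:: m; 0; 0; 0; 0]).
Qed.

Definition copy (i j k : nat) : prog :=
  While i (Seq (Dec i) (Seq (Inc j) (Inc k))).

Lemma recursive_pair f g : recursive f -> recursive g ->
  recursive (fun n => code_pair (f n) (g n)).
Proof.
move=> rf rg.
(* From the input [x], [eval] leaves [g x] in counter 0 and [f x] in counter 1. *)
pose eval := Seq (copy 0 1 2) (Seq (move 1 0) (Seq (Call true) (Seq (move 0 1)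
  (Seq (move 2 0) (Call false))))).
(* With [b] and [a] in counters 0 and 1, the first copy puts [a + b] into counter 1 and [b] into
   counter 2; the loop then adds [a + b], ..., 2, 1 to counter 2, in total the binomial coefficient
   of Cantor's pairing. *)
pose pack := Seq (copy 0 1 2) (Seq
  (While 1 (Seq (copy 1 2 3) (Seq (Dec 3) (move 3 1)))) (move 2 0)).
apply: (@recursive_prog f g (Seq eval pack)) => // x.
have copy012 a b : exec f g (copy 0 1 2) [:: a; b; 0; 0; 0] [:: 0; b + a; a; 0; 0].
  have := @exec_while f g 0 (Seq (Dec 0) (Seq (Inc 1) (Inc 2))) a
    (fun m => [:: m; b + (a - m); a - m; 0; 0]).
  rewrite /= subnn subn0 addn0; apply=> // m ma.
  by do 2!eexists => //=; congr [:: _; _; _; _; _]; lia.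
have copy123 a b : exec f g (copy 1 2 3) [:: 0; a; b; 0; 0] [:: 0; 0; b + a; a; 0].
  have := @exec_while f g 1 (Seq (Dec 1) (Seq (Inc 2) (Inc 3))) a
    (fun m => [:: 0; m; b + (a - m); a - m; 0]).
  rewrite /= subnn subn0 addn0; apply=> // m ma.
  by do 2!eexists => //=; congr [:: _; _; _; _; _]; lia.
exists [:: g x; f x; 0; 0; 0].
  exists [:: 0; x; x; 0; 0]; first exact: copy012.
  exists [:: x; 0; x; 0; 0]; first exact: (@exec_move f g 1 0 [:: 0; x; x; 0; 0]).
  exists [:: f x; 0; x; 0; 0] => //.
  exists [:: 0; f x; x; 0; 0]; first exact: (@exec_move f g 0 1 [:: f x; 0; x; 0; 0]).
  exists [:: x; f x; 0; 0; 0]; first exact: (@exec_move f g 2 0 [:: 0; f x; x; 0; 0]).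
  by [].
move: (g x) (f x) => b a.
exists [:: 0; a + b; b; 0; 0]; first exact: copy012.
exists [:: 0; 0; code_pair a b; 0; 0]; last first.
  exact: (@exec_move f g 2 0 [:: 0; 0; _; 0; 0]).
pose W m := [:: 0; m; b + ('C((a + b).+1, 2) - 'C(m.+1, 2)); 0; 0].
have -> : [:: 0; a + b; b; 0; 0] = W (a + b) by rewrite /W subnn addn0.
have -> : [:: 0; 0; code_pair a b; 0; 0] = W 0 by rewrite /W /code_pair subn0 addnC.
apply: exec_while => // m mab; exists [:: 0; 0; nth 0 (W m.+1) 2 + m.+1; m.+1; 0].
  exact: copy123.
exists [:: 0; 0; nth 0 (W m.+1) 2 + m.+1; m; 0] => //.
suff -> : W m = [:: 0; m; nth 0 (W m.+1) 2 + m.+1; 0; 0].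
  exact: (@exec_move f g 3 1 [:: 0; 0; _; m; 0]).
congr [:: _; _; _; _; _] => /=.
have : 'C(m.+2, 2) <= 'C((a + b).+1, 2) by apply: leq_bin2l.
by rewrite (binS m.+1 1) bin1; lia.
Qed.

(** The successor in the order of Cantor's codes: one step along a diagonal, or on to the start of
    the next diagonal. *)
Definition next_pair (p : nat * nat) : nat * nat :=
  if p.1 is m.+1 then (m, p.2.+1) else (p.2.+1, 0).

Definition unpair (k : nat) : nat * nat := iter k next_pair (0, 0).

Lemma unpairK k : code_pair (unpair k).1 (unpair k).2 = k.
Proof.
elim: k => //= k; case: (unpair k) => -[|m] n /= <-; rewrite /code_pair.
  by rewrite add0n !addn0 (binS n.+1 1) bin1; lia.
by rewrite /= addSnnS addnS.
Qed.

Lemma code_pairK m n : unpair (code_pair m n) = (m, n).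
Proof.
by have := code_pair_inj (unpairK (code_pair m n)); case: (unpair _) => ? ? ->.
Qed.

Definition unpack : prog :=
  While 0 (Seq (Dec 0) (If 1 (Seq (Dec 1) (Inc 2)) (Seq (Inc 1) (move 2 1)))).

Lemma exec_unpack f g k : exec f g unpack [:: k; 0; 0; 0; 0]
  [:: 0; (unpair k).1; (unpair k).2; 0; 0].
Proof.
pose W m := [:: m; (unpair (k - m)).1; (unpair (k - m)).2; 0; 0].
have -> : [:: k; 0; 0; 0; 0] = W k by rewrite /W subnn.
have -> : [:: 0; (unpair k).1; (unpair k).2; 0; 0] = W 0 by rewrite /W subn0.
apply: exec_while => // m mk; eexists; first by [].
rewrite /W /= (_ : k - m = (k - m.+1).+1) /=; last by lia.
case: (unpair (k - m.+1)) => -[|a] b /=; last by eexists.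
by eexists; [by []|exact: (@exec_move f g 2 1 [:: m; 1; b; 0; 0])].
Qed.

Lemma recursive_fst : recursive (fun k => (unpair k).1).
Proof.
apply: (@recursive_prog id id (Seq unpack (Seq (While 2 (Dec 2)) (move 1 0))) _
  recursive_id recursive_id) => // k.
eexists; first exact: exec_unpack.
eexists; first exact: (@exec_clear _ _ 2 [:: 0; _; _; 0; 0]).
exact: (@exec_move _ _ 1 0 [:: 0; _; 0; 0; 0]).
Qed.

Lemma recursive_snd : recursive (fun k => (unpair k).2).
Proof.
apply: (@recursive_prog id id (Seq unpack (Seq (While 1 (Dec 1)) (move 2 0))) _
  recursive_id recursive_id) => // k.
eexists; first exact: exec_unpack.
eexists; first exact: (@exec_clear _ _ 1 [:: 0; _; _; 0; 0]).
exact: (@exec_move _ _ 2 0 [:: 0; 0; _; 0; 0]).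
Qed.

Lemma recursive_iter_pair f : recursive f ->
  recursive (fun k => iter (unpair k).1 f (unpair k).2).
Proof.
move=> rf; apply: (@recursive_prog f f (Seq unpack (Seq (move 2 0)
  (While 1 (Seq (Dec 1) (Call true)))))) => // k.
eexists; first exact: exec_unpack.
move: (unpair k).1 (unpair k).2 => m n.
exists [:: n; m; 0; 0; 0]; first exact: (@exec_move _ _ 2 0 [:: 0; m; n; 0; 0]).
pose W j := [:: iter (m - j) f n; j; 0; 0; 0].
have -> : [:: n; m; 0; 0; 0] = W m by rewrite /W subnn.
have -> : [:: iter m f n; 0; 0; 0; 0] = W 0 by rewrite /W subn0.
apply: exec_while => // j jm; eexists; first by [].
by rewrite /W /= (_ : m - j = (m - j.+1).+1) //; lia.
Qed.

Definition recursive2 (F : nat -> nat -> nat) : Prop :=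
  recursive (fun k => F (unpair k).1 (unpair k).2).

Lemma recursive2_comp F f g : recursive2 F -> recursive f -> recursive g ->
  recursive (fun n => F (f n) (g n)).
Proof.
move=> rF rf rg; have := recursive_comp rF (recursive_pair rf rg).
by congr recursive; apply/funext => n /=; rewrite code_pairK.
Qed.

(** Primitive recursion in the form of iteration with a parameter; the arithmetic below rests on it.
    The parameter [n] is carried along unchanged in the first component of the iterated pair. *)
Lemma recursive_iter F f g : recursive2 F -> recursive f -> recursive g ->
  recursive (fun n => iter (f n) (F n) (g n)).
Proof.
move=> rF rf rg.
pose step p := code_pair (unpair p).1 (F (unpair p).1 (unpair p).2).
have rstep : recursive step by exact: recursive_pair recursive_fst rF.
have := recursive_comp recursive_snd (recursive2_comp
  (F := fun m s => iter m step s) (recursive_iter_pair rstep) rf (recursive_pair recursive_id rg)).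
congr recursive; apply/funext => n /=.
suff -> : iter (f n) step (code_pair n (g n)) =
  code_pair n (iter (f n) (F n) (g n)) by rewrite code_pairK.
by elim: (f n) => //= k ->; rewrite /step code_pairK.
Qed.

Section Arithmetic.
Variables (f g : nat -> nat).
Hypotheses (rf : recursive f) (rg : recursive g).

Lemma recursive_add : recursive (fun n => f n + g n).
Proof.
have := recursive_iter (F := fun _ => succn)
  (recursive_comp recursive_succ recursive_snd) rf rg.
by congr recursive; apply/funext => n; rewrite iter_succn addnC.
Qed.

Lemma recursive_pred : recursive (fun n => (f n).-1).
Proof.
(* The second component counts up and the first lags one behind it; the start 0 is the code of the
   pair of zeros. *)
have r : recursive2 (fun _ s => code_pair (unpair s).2 (unpair s).2.+1).
  have rs := recursive_comp recursive_snd recursive_snd.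
  exact: recursive_pair rs (recursive_comp recursive_succ rs).
have := recursive_comp recursive_fst (recursive_iter r rf (recursive_cst 0)).
congr recursive; apply/funext => n /=; rewrite (_ : iter _ _ _ = code_pair (f n).-1 (f n)).
  by rewrite code_pairK.
by elim: (f n) => //= k ->; rewrite code_pairK.
Qed.

End Arithmetic.

Lemma recursive_sub f g : recursive f -> recursive g ->
  recursive (fun n => f n - g n).
Proof.
move=> rf rg; have := recursive_iter (F := fun _ => predn) (recursive_pred recursive_snd) rg rf.
by congr recursive; apply/funext => n; rewrite iter_predn.
Qed.

Lemma recursive_mul f g : recursive f -> recursive g ->
  recursive (fun n => f n * g n).
Proof.
move=> rf rg; have r : recursive2 (fun n s => g n + s).
  exact: recursive_add (recursive_comp rg recursive_fst) recursive_snd.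
have := recursive_iter r rf (recursive_cst 0).
by congr recursive; apply/funext => n; rewrite iter_addn_0 mulnC.
Qed.

Lemma recursive_exp f g : recursive f -> recursive g ->
  recursive (fun n => f n ^ g n).
Proof.
move=> rf rg; have r : recursive2 (fun n s => f n * s).
  exact: recursive_mul (recursive_comp rf recursive_fst) recursive_snd.
have := recursive_iter r rg (recursive_cst 1).
by congr recursive; apply/funext => n; elim: (g n) => //= k ->; rewrite expnS.
Qed.

Lemma recursive_leq f g : recursive f -> recursive g ->
  recursive (fun n => (f n <= g n) : nat).
Proof.
move=> rf rg; have := recursive_sub (recursive_cst 1) (recursive_sub rf rg).
by congr recursive; apply/funext => n; rewrite -subn_eq0; case: (f n - g n).
Qed.

Lemma recursive_if (b : nat -> bool) f g :
  recursive (fun n => b n : nat) -> recursive f -> recursive g ->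
  recursive (fun n => if b n then f n else g n).
Proof.
move=> rb rf rg; have := recursive_add (recursive_mul rb rf)
  (recursive_mul (recursive_sub (recursive_cst 1) rb) rg).
by congr recursive; apply/funext => n; case: (b n); lia.
Qed.

(* [a %/ d] counts the successes of the greedy search for the largest [s] with
   [s * d <= a]. *)
Lemma recursive_div f g : recursive f -> recursive g ->
  recursive (fun n => f n %/ g n).
Proof.
move=> rf rg; have rs := recursive_snd.
have r : recursive2 (fun n s => if s.+1 * g n <= f n then s.+1 else s).
  have rS := recursive_comp recursive_succ rs.
  have rleq := recursive_leq (recursive_mul rS (recursive_comp rg recursive_fst))
    (recursive_comp rf recursive_fst).
  exact: (recursive_if rleq rS rs).
have r1 := recursive_iter r rf (recursive_cst 0).
(* With divisor 0 the greedy search never fails, whereas [divn] yields 0. *)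
have := recursive_if (recursive_leq rg (recursive_cst 0)) (recursive_cst 0) r1.
congr recursive; apply/funext => n; case: ifP => [|/negbT]; rewrite leqn0.
  by move/eqP->; rewrite divn0.
rewrite -lt0n => g0; move: (f n) (g n) g0 => a d d0.
suff E k : iter k (fun s => if s.+1 * d <= a then s.+1 else s) 0 = minn k (a %/ d).
  by rewrite E; apply/minn_idPr; exact: leq_div.
elim: k => [|k /= ->]; first by rewrite min0n.
rewrite -leq_divRL //; case: ltnP; lia.
Qed.

Lemma recursive_odd f : recursive f -> recursive (fun n => odd (f n) : nat).
Proof.
move=> rf; have r := recursive_mul (recursive_div rf (recursive_cst 2)) (recursive_cst 2).
have := recursive_sub rf r.
by congr recursive; apply/funext => n; rewrite divn2 muln2; lia.
Qed.

End Recursive.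

(** * Products along situations *)

Section PathProducts.
Local Open Scope nat_scope.

(** Codes number situations like a binary heap: the children of [c] are [2c + 1] and [2c + 2], and
    the root 0 is its own parent. *)
Definition parent (c : nat) : nat := c.-1./2.

Lemma parent_code s x : parent (code_situation (rcons s x)) = code_situation s.
Proof. by rewrite code_situation_rcons /parent; case: x; lia. Qed.

Fixpoint rev_path_prod (W : nat -> nat) (r : situation) : nat :=
  if r is _ :: r' then W (code_situation (rev r)) * rev_path_prod W r' else 1.

(* The product of [W (code_situation u)] over the non-empty prefixes [u] of [s]. *)
Definition path_prod (W : nat -> nat) (s : situation) : nat :=
  rev_path_prod W (rev s).

Lemma path_prod_nil W : path_prod W [::] = 1.
Proof. by []. Qed.

Lemma path_prod_rcons W s x : path_prod W (rcons s x) =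
  W (code_situation (rcons s x)) * path_prod W s.
Proof. by rewrite /path_prod -[in RHS](revK (rcons s x)) rev_rcons. Qed.

Lemma path_prod_gt0 W s : (forall c, 0 < W c) -> 0 < path_prod W s.
Proof.
by move=> W0; elim/last_ind: s => // s x IH; rewrite path_prod_rcons muln_gt0 W0.
Qed.

Lemma recursive_parent f : recursive f -> recursive (fun n => parent (f n)).
Proof.
move=> rf; have := recursive_div (recursive_pred rf) (recursive_cst 2).
by congr recursive; apply/funext => n; rewrite divn2.
Qed.

Lemma path_prod_recursive W : recursive W ->
  exists2 g, recursive g & forall s, g (code_situation s) = path_prod W s.
Proof.
move=> rW.
(* Climbs from a code to its parent while accumulating factors. At the root the factor is 1, so
   further steps change nothing. *)
pose step p := code_pair (parent (unpair p).1)
  ((if (unpair p).1 <= 0 then 1 else W (unpair p).1) * (unpair p).2).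
have rstep : recursive step.
  apply: recursive_pair; first exact: recursive_parent recursive_fst.
  apply: recursive_mul recursive_snd.
  apply: recursive_if (recursive_leq recursive_fst (recursive_cst 0))
    (recursive_cst 1) (recursive_comp rW recursive_fst).
(* As many steps as the code itself suffice, since each one strictly lowers a nonzero code. *)
exists (fun c => (unpair (iter c step (code_pair c 1))).2).
  apply: recursive_comp recursive_snd _.
  apply: (recursive_iter (F := fun=> step) (recursive_comp rstep recursive_snd)
    recursive_id (recursive_pair recursive_id (recursive_cst 1))).
suff E k s a : code_situation s <= k ->
    iter k step (code_pair (code_situation s) a) = code_pair 0 (path_prod W s * a).
  by move=> s; rewrite E // code_pairK /= muln1.
elim: k s a => [|k IH] s a; case/lastP: s => [|s x]; rewrite ?code_situation_rcons //.
- by rewrite mul1n.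
- move=> _; rewrite iterSr [step _]/step code_pairK /= mul1n.
  by have := IH [::] a isT; rewrite path_prod_nil mul1n; apply.
move=> ck; rewrite -code_situation_rcons iterSr [step _]/step code_pairK /= parent_code.
rewrite {1}code_situation_rcons leqn0 /= IH; last by case: x ck; lia.
by rewrite path_prod_rcons mulnCA mulnA.
Qed.

End PathProducts.

(** * Rational product processes and the overlap of forecasts *)

Section Randomness.
Variable R : realType.
Implicit Types (I J : interval_forecast R) (omega : binary_path).

Definition ratio_process (W V : nat -> nat) : real_process R :=
  fun s => (path_prod W s)%:R / (path_prod V s)%:R.

Definition step_ratio (W V : nat -> nat) (s : situation) (x : bool) : R :=
  (W (code_situation (rcons s x)))%:R / (V (code_situation (rcons s x)))%:R.

Lemma ratio_process_rcons W V s x :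
  ratio_process W V (rcons s x) = ratio_process W V s * step_ratio W V s x.
Proof.
by rewrite /ratio_process !path_prod_rcons !natrM invfM mulrACA mulrC.
Qed.

Lemma computable_ratio_process W V : recursive W -> recursive V ->
  (forall c, 0 < V c)%N -> computable_process (ratio_process W V).
Proof.
move=> /path_prod_recursive[w rw wE] /path_prod_recursive[v rv vE] V0.
(* The values are rational, so they approximate themselves without error and the modulus can be
   0. *)
exists (fun s _ => (path_prod W s)%:R / (path_prod V s)%:R), (fun _ _ => 0%N).
have fam h (H : situation -> nat) : recursive h ->
    (forall s, h (code_situation s) = H s) -> recursive_family (fun s _ => H s).
  move=> rh hE; exists (fun k => h (unpair k).1).
    exact: recursive_comp rh recursive_fst.
  by move=> s n; rewrite code_pairK hE.
split.
- exists (fun _ _ => 0%N), (fun s _ => path_prod W s), (fun s _ => path_prod V s).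
  split; [exact: fam (recursive_cst 0) _|exact: fam rw wE|exact: fam rv vE| |].
    by move=> s n; exact: path_prod_gt0.
  by move=> s n; rewrite expr0 mul1r.
- exact: fam (recursive_cst 0) _.
by move=> s N n _; rewrite fmorph_div /= !ratr_nat subrr normr0 invr_ge0 exprn_ge0.
Qed.

Lemma upper_expectation_le0 I f :
  upper_expectation I f <= 0 <->
  forall p, forecast_set I p -> p * f true + (1 - p) * f false <= 0.
Proof.
have [[p Ip ->] le_p] := upper_expectation_max I f.
by split=> [f0 q /le_p/le_trans -> //|]; exact.
Qed.

(** The form in which randomness is used: a product of recursive rational factors whose expectation
    is at most 1 at each step is a computable test supermartingale. *)
Lemma ratio_process_bounded omega I W V :
  computably_random (stationary I) omega -> recursive W -> recursive V ->
  (forall c, 0 < V c)%N ->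
  (forall s p, forecast_set I p ->
     p * step_ratio W V s true + (1 - p) * step_ratio W V s false <= 1) ->
  exists B, forall n, ratio_process W V (Defs.prefix_path omega n) <= B.
Proof.
move=> rnd rW rV V0 sub; pose P := ratio_process W V.
have Pge0 s : 0 <= P s by rewrite divr_ge0.
have P1 : P [::] = 1 by rewrite /P /ratio_process divr1.
have : test_supermartingale (stationary I) P.
  split=> // s; apply/upper_expectation_le0 => p Ip; rewrite /increment.
  by rewrite /P !ratio_process_rcons -/(P s); have := sub s p Ip; have := Pge0 s; nra.
move=> /(rnd _ (computable_ratio_process rW rV V0)).
(* The supremum ranges over non-empty prefixes only; the maximum with 1 covers the empty one. *)
set A := [set _ | _ in _] => Afin; exists (Num.max 1 (fine (ereal_sup A))) => -[|n].
  by rewrite -[ratio_process _ _ _]/(P [::]) P1 le_max lexx.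
have : ((P (Defs.prefix_path omega n.+1))%:E <= ereal_sup A)%E.
  by apply: ereal_sup_ubound; exists n.+1.
rewrite le_max; case: (ereal_sup A) Afin => //= r _; rewrite lee_fin => ->.
by rewrite orbT.
Qed.

Lemma prefix_pathS omega n :
  Defs.prefix_path omega n.+1 = rcons (Defs.prefix_path omega n) (omega n).
Proof. exact: mkseqS. Qed.

(* With [k/n] and [(k+1)/n] separating [I] from [J], one bets the proportion
   [1/(2n)] against frequencies above [k/n], and in parallel against frequencies
   below [(k+1)/n]; the product of both capitals grows exponentially along every
   path. *)
Lemma forecasts_not_separated omega I J (b a : R) :
  computably_random (stationary I) omega ->
  computably_random (stationary J) omega ->
  (forall p, forecast_set I p -> p <= b) ->
  (forall p, forecast_set J p -> a <= p) ->
  0 <= b -> a <= 1 -> a <= b.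
Proof.
move=> rndI rndJ Ib Ja b0 a1; rewrite leNgt; apply/negP => ab.
(* The gap, scaled by [n], exceeds 2, and [k <= n b + 1]; this leaves room for [n b <= k] and
   [k + 1 <= n a]. *)
pose n := (Num.truncn (2 / (a - b))).+1; pose k := (Num.truncn (n%:R * b)).+1.
have n0 : 0 < n%:R :> R by rewrite ltr0n.
have nab : 2 < n%:R * (a - b).
  by rewrite -ltr_pdivrMr ?subr_gt0 //; exact: truncnS_gt.
have kb : n%:R * b <= k%:R by apply/ltW/truncnS_gt.
have ka : k%:R + 1 <= n%:R * a.
  have : (Num.truncn (n%:R * b))%:R <= n%:R * b by rewrite truncn_le mulr_ge0 // ltW.
  by rewrite /k -natr1; nra.
have kn : (k < n)%N by rewrite -(ltr_nat R) -natr1 in ka *; nra.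
move: n k n0 nab kb ka kn => n k n0 nab kb ka kn.
pose D := (2 * n ^ 2)%N.
(* Appending 0 gives an odd code and appending 1 an even one. *)
pose W w1 w0 (c : nat) : nat := if odd c then w0 else w1.
have rW w1 w0 : recursive (W w1 w0).
  exact: recursive_if (recursive_odd recursive_id) (recursive_cst _) (recursive_cst _).
pose V (c : nat) := D.
have rV : recursive V by exact: recursive_cst.
have V0 c : (0 < V c)%N.
  by rewrite /V /D muln_gt0 expn_gt0 /= (leq_ltn_trans _ kn).
have WE w1 w0 s x : W w1 w0 (code_situation (rcons s x)) = if x then w1 else w0.
  by rewrite code_situation_rcons /W /= oddD odd_double; case: x.
have DE : D%:R = 2 * n%:R ^+ 2 :> R by rewrite /D natrM natrX.
have D0 : 0 < 2 * n%:R ^+ 2 :> R by rewrite mulr_gt0 // exprn_gt0.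
have kD : (k + n <= D)%N by rewrite /D; nia.
(* Over the common denominator [D], the factors on outcome [x] are [1 + (x - k/n)/(2n)] and
   [1 + ((k+1)/n - x)/(2n)]. *)
pose w1 := (D + n - k)%N; pose w0 := (D - k)%N.
pose w1' := (D + k.+1 - n)%N; pose w0' := (D + k.+1)%N.
have w1E : w1%:R = D%:R + n%:R - k%:R :> R by rewrite natrB ?natrD //; lia.
have w0E : w0%:R = D%:R - k%:R :> R by rewrite natrB //; lia.
have w1E' : w1'%:R = D%:R + k%:R + 1 - n%:R :> R.
  by rewrite natrB ?natrD -?natr1 ?addrA //; lia.
have w0E' : w0'%:R = D%:R + k%:R + 1 :> R by rewrite natrD -natr1 addrA.
have avg (p x y : R) : p * x + (1 - p) * y <= D%:R ->
    p * (x / D%:R) + (1 - p) * (y / D%:R) <= 1.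
  by rewrite !mulrA -mulrDl DE ler_pdivrMr // mul1r.
have [B1 PB1] : exists B, forall m, ratio_process (W w1 w0) V (Defs.prefix_path omega m) <= B.
  apply: (ratio_process_bounded rndI) => // s p /Ib pb; rewrite /step_ratio !WE.
  rewrite w1E w0E; apply: avg; nra.
have [B2 PB2] : exists B, forall m, ratio_process (W w1' w0') V (Defs.prefix_path omega m) <= B.
  apply: (ratio_process_bounded rndJ) => // s p /Ja pa; rewrite /step_ratio !WE.
  rewrite w1E' w0E'; apply: avg; nra.
pose P s : R := ratio_process (W w1 w0) V s * ratio_process (W w1' w0') V s.
have Pge0 s : 0 <= P s by rewrite mulr_ge0 // divr_ge0.
(* The linear terms of the two factors add up to [1/(2n^2)] for either outcome, and the product of
   these terms is at least [-1/(4n^2)] as [0 <= k < n]. Hence each step multiplies the product of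
   the capitals by at least [1 + d]. *)
pose d : R := (4 * n%:R ^+ 2)^-1.
have d0 : 0 < d by rewrite invr_gt0 mulr_gt0 // exprn_gt0.
have Pgrow s x : P s * (1 + d) <= P (rcons s x).
  have -> : P (rcons s x) = P s *
      ((if x then w1%:R * w1'%:R else w0%:R * w0'%:R) / (D%:R * D%:R)).
    rewrite /P /ratio_process !path_prod_rcons !WE /V !natrM.
    have ? : n%:R != 0 :> R by rewrite gt_eqF.
    have ? : (path_prod (fun=> D) s)%:R != 0 :> R.
      by rewrite pnatr_eq0 -lt0n path_prod_gt0.
    by case: x; field; apply/andP.
  apply: ler_wpM2l => //; rewrite ler_pdivlMr ?mulr_gt0 ?DE //.
  have -> : (1 + d) * (2 * n%:R ^+ 2 * (2 * n%:R ^+ 2)) = 4 * n%:R ^+ 4 + n%:R ^+ 2.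
    by rewrite /d; field; rewrite gt_eqF.
  have kn' : k%:R + 1 <= n%:R :> R by rewrite natr1 ler_nat.
  have k0 : 0 <= k%:R :> R by [].
  by case: x; rewrite ?w1E ?w1E' ?w0E ?w0E' DE; nra.
(* Bernoulli's inequality; linear growth already contradicts boundedness. *)
have Plow m : 1 + m%:R * d <= P (Defs.prefix_path omega m).
  elim: m => [|m IH].
    by rewrite mul0r addr0 /P /ratio_process /path_prod /= divr1 mulr1.
  rewrite prefix_pathS; apply: le_trans (Pgrow _ _); rewrite -natr1.
  have : 0 <= m%:R :> R by []. 
  by nra.
have [B PB] : exists B, forall m, P (Defs.prefix_path omega m) <= B.
  exists (B1 * B2) => m; apply: ler_pM => //; rewrite divr_ge0 //.
have := PB (Num.truncn (B / d)).+1; apply/negP; rewrite -ltNge.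
apply: lt_le_trans (Plow _); rewrite -ltrBlDl (@lt_trans _ _ B) //; first by lra.
by rewrite -ltr_pdivrMr // truncnS_gt.
Qed.

End Randomness.

(** * Rational approximation of computable supermartingales *)

Section Approximation.
Variable R : realType.
Implicit Types (I J K : interval_forecast R) (T : real_process R).

Lemma nat_approximation T : computable_process T -> (forall s, 0 <= T s) ->
  exists2 B : nat -> nat, recursive B & forall s,
    `|(B (code_situation s))%:R / 2 ^+ code_situation s - T s| <=
      2 / 2 ^+ code_situation s.
Proof.
move=> [r [e [[sg [a [b [[gsg rsg sgE] [ga ra aE] [gb rb bE] b0 rE]]]] [ge re eE] Tr]]] T0.
(* Codes the situation together with an index at which its approximation is within [2 ^- c]. *)
pose k c := code_pair c (ge (code_pair c c)).
have rk : recursive k.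
  apply: recursive_pair recursive_id _.
  exact: recursive_comp re (recursive_pair recursive_id recursive_id).
(* A negative approximation is replaced by 0, which is no farther from the non-negative [T].
   Otherwise the division rounds down to a multiple of [2 ^- c], which accounts for the second unit
   of error. *)
exists (fun c => if odd (gsg (k c)) then 0 else 2 ^ c * ga (k c) %/ gb (k c))%N.
  apply: recursive_if; [|exact: recursive_cst|].
    exact: recursive_odd (recursive_comp rsg rk).
  apply: recursive_div (recursive_comp rb rk).
  apply: recursive_mul (recursive_comp ra rk).
  exact: recursive_exp (recursive_cst 2) recursive_id.
move=> s; rewrite /k eE sgE aE bE; set c := code_situation s.
have := Tr s c _ (leqnn _); rewrite rE; move: (e s c) => m; rewrite !rmorphM /= rmorphXn rmorphN1 fmorphV /= !ratr_nat.
rewrite -signr_odd; have := T0 s; set E : R := 2 ^+ c.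
have E0 : 0 < E by rewrite exprn_gt0.
have bm0 : 0 < (b s m)%:R :> R by rewrite ltr0n.
have x0 : 0 <= (a s m)%:R / (b s m)%:R :> R by rewrite divr_ge0.
have Ei : 0 < E^-1 by rewrite invr_gt0.
rewrite !ler_norml -/E; case: odd; rewrite ?expr1 ?expr0 ?mulN1r ?mul1r.
  rewrite mul0r mulNr; set x := _ / _ in x0 *; lra.
set q := (_ %/ _)%N; have qE := divn_eq (2 ^ c * a s m) (b s m).
have qlt := ltn_pmod (2 ^ c * a s m) (b0 s m).
have q1 : q%:R * (b s m)%:R <= E * (a s m)%:R.
  by rewrite /E -natrX -!natrM ler_nat; lia.
have q2 : E * (a s m)%:R <= (q%:R + 1) * (b s m)%:R.
  by rewrite /E -natrX natr1 -!natrM ler_nat; lia.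
set x := _ / _ in x0 *.
have xq : q%:R / E <= x.
  by rewrite ler_pdivrMr // mulrC mulrA ler_pdivlMr.
have qx : x <= (q%:R + 1) / E.
  by rewrite ler_pdivlMr // mulrAC ler_pdivrMr // mulrC.
rewrite mulrDl in qx; lra.
Qed.

(* The term 6 makes up for the approximation error, and keeps doing so in the
   supermartingale inequality because codes at least increase by one along
   paths. *)
Lemma nat_supermartingale K T : computable_process T ->
  test_supermartingale (stationary K) T ->
  exists A : nat -> nat, [/\ recursive A, forall c, (0 < A c)%N &
    let Q s : R := (A (code_situation s))%:R / 2 ^+ code_situation s in
    (forall s, T s <= Q s) /\
    forall s p, forecast_set K p ->
      p * Q (rcons s true) + (1 - p) * Q (rcons s false) <= Q s].
Proof.
move=> cT [[T0 _] Tsuper]; have [B rB BT] := nat_approximation cT T0.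
exists (fun c => B c + 6)%N; split.
- exact: recursive_add rB (recursive_cst 6).
- by move=> c; rewrite addnS.
have QT s : let c := code_situation s in
    T s + 4 / 2 ^+ c <= (B c + 6)%:R / 2 ^+ c <= T s + 8 / 2 ^+ c.
  by have := BT s; rewrite /= natrD mulrDl ler_norml; lra.
move=> Q; split=> [s|s p Kp].
  by have /andP[+ _] := QT s; apply: le_trans; rewrite lerDl divr_ge0 //.
have p01 : 0 <= p <= 1.
  have [x [y [x0 _ y1 KE]]] := forecast_setP K.
  by move: Kp; rewrite KE /= in_itv /= => /andP[? ?]; lra.
have := (upper_expectation_le0 _ _).1 (Tsuper s) p Kp; rewrite /increment => sub.
(* The surplus of [Q] over [T] is between 4 and 8 units of [2 ^- c]. A child's unit is at most half
   its parent's, so 8 units there are at most 4 here. *)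
have child x : Q (rcons s x) <= T (rcons s x) + 4 / 2 ^+ code_situation s.
  have /andP[_] := QT (rcons s x); move/le_trans; apply; rewrite lerD2l.
  rewrite ler_pdivrMr ?exprn_gt0 // mulrAC ler_pdivlMr ?exprn_gt0 //.
  rewrite (_ : 8 = 4 * 2) -?mulrA -?exprS; last by rewrite -natrM.
  rewrite ler_pM2l // ler_eXn2l ?ltr1n // code_situation_rcons.
  by case: x; lia.
have /andP[] := QT s; rewrite -/(Q s); move: (child true) (child false) sub.
set d := 4 / _ => childt childf sub Qs _; have /andP[p0 p1] := p01.
have : 0 <= p * (T (rcons s true) + d - Q (rcons s true)) +
    (1 - p) * (T (rcons s false) + d - Q (rcons s false)).
  by apply: addr_ge0; apply: mulr_ge0; rewrite ?subr_ge0.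
lra.
Qed.

End Approximation.

(** * Splitting a supermartingale into its upward and its downward bets *)

Section Splitting.
Variables (R : realType) (A : nat -> nat) (rA : recursive A).
Hypothesis A_gt0 : forall c, (0 < A c)%N.
Implicit Type s : situation.

Let Q s : R := (A (code_situation s))%:R / 2 ^+ code_situation s.

Let Q_gt0 s : 0 < Q s.
Proof. by rewrite divr_gt0 ?exprn_gt0 // ltr0n. Qed.

(* [Q (rcons s false) <= Q (rcons s true)] in terms of the code of [s]. *)
Definition bets_upward (c : nat) : bool := (A c.*2.+1 * 2 <= A c.*2.+2)%N.

Let bets_upwardE s : bets_upward (code_situation s) =
  (Q (rcons s false) <= Q (rcons s true)).
Proof.
rewrite /bets_upward /Q !code_situation_rcons addn0 addn1.
rewrite ler_pdivrMr ?exprn_gt0 // mulrAC ler_pdivlMr ?exprn_gt0 //.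
rewrite [X in _ = (_ * X <= _)]exprS mulrA ler_pM2r ?exprn_gt0 //.
by rewrite -natrM ler_nat.
Qed.

(** Together with [bet_den], the relative change of [Q] from the parent of [c] to [c] as a fraction
    of naturals where [b] selects the bet, and 1 elsewhere. *)
Definition bet_num (b : nat -> bool) (c : nat) : nat :=
  if b (parent c) then (A c * 2 ^ parent c)%N else 1%N.

Definition bet_den (b : nat -> bool) (c : nat) : nat :=
  if b (parent c) then (A (parent c) * 2 ^ c)%N else 1%N.

Lemma bet_den_gt0 b c : (0 < bet_den b c)%N.
Proof. by rewrite /bet_den; case: ifP => // _; rewrite muln_gt0 A_gt0 expn_gt0. Qed.

Let bet_ratio b s x :
  step_ratio R (bet_num b) (bet_den b) s x =
  if b (code_situation s) then Q (rcons s x) / Q s else 1 :> R.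
Proof.
rewrite /step_ratio /bet_num /bet_den parent_code; case: ifP => // _; rewrite ?divr1 //.
by rewrite /Q invf_div !natrM !natrX; field; rewrite !expf_neq0 //= pnatr_eq0 -lt0n A_gt0.
Qed.

Lemma recursive_bets (b : nat -> bool) : recursive (fun c => b c : nat) ->
  recursive (bet_num b) /\ recursive (bet_den b).
Proof.
move=> rb; have rp := recursive_parent recursive_id.
have rbp := recursive_comp rb rp; have two := recursive_cst 2.
split; apply: (recursive_if rbp) (recursive_cst 1).
  exact: recursive_mul rA (recursive_exp two rp).
exact: recursive_mul (recursive_comp rA rp) (recursive_exp two recursive_id).
Qed.

Lemma recursive_bets_upward : recursive (fun c => bets_upward c : nat).
Proof.
have rS := recursive_comp recursive_succ.
have r2 : recursive (fun c => c.*2.+1).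
  have := rS _ (recursive_mul recursive_id (recursive_cst 2)).
  by congr recursive; apply/funext => c /=; rewrite muln2.
apply: recursive_leq (recursive_comp rA (rS _ r2)).
exact: recursive_mul (recursive_comp rA r2) (recursive_cst 2).
Qed.

(** At every situation exactly one of the two processes moves, by the relative change of [Q], so the
    product telescopes. *)
Lemma split_ratio_process s :
  ratio_process R (bet_num bets_upward) (bet_den bets_upward) s *
  ratio_process R (bet_num (negb \o bets_upward)) (bet_den (negb \o bets_upward)) s =
  Q s / Q [::].
Proof.
elim/last_ind: s => [|s x IH].
  by rewrite /ratio_process !path_prod_nil !divr1 mulr1 divff // gt_eqF.
have ratioE b : ratio_process R (bet_num b) (bet_den b) (rcons s x) =
    ratio_process R (bet_num b) (bet_den b) s *
    (if b (code_situation s) then Q (rcons s x) / Q s else 1).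
  by rewrite -bet_ratio ratio_process_rcons.
rewrite !ratioE mulrACA IH /=.
have : Q s != 0 by rewrite gt_eqF.
have : Q [::] != 0 by rewrite gt_eqF.
move: (Q _) (Q _) (Q _) => q0 qs q q0_neq0 qs_neq0.
by case: bets_upward => /=; field; apply/andP.
Qed.

(** Where a one pays at least as much as a zero, the expectation of [Q] is non-decreasing in the
    probability of a one, so the inequality at [d] carries over to every [p <= d]. Elsewhere the
    factor is constantly 1. *)
Lemma upward_bets_bounded omega I d :
  computably_random (stationary I) omega ->
  (forall p, forecast_set I p -> p <= d) ->
  (forall s, d * Q (rcons s true) + (1 - d) * Q (rcons s false) <= Q s) ->
  exists B, forall n, ratio_process R (bet_num bets_upward)
    (bet_den bets_upward) (Defs.prefix_path omega n) <= B.
Proof.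
move=> rnd Id sub; have [rn rd] := recursive_bets recursive_bets_upward.
apply: (ratio_process_bounded rnd rn rd (bet_den_gt0 _)) => s p /Id pd.
rewrite !bet_ratio bets_upwardE; case: ifP => [le_ft|_]; last by lra.
rewrite (mulrA p) (mulrA (1 - p)) -mulrDl ler_pdivrMr // mul1r; apply: le_trans (sub s).
have : 0 <= (d - p) * (Q (rcons s true) - Q (rcons s false)).
  by rewrite mulr_ge0 // subr_ge0.
by move: (Q (rcons s true)) (Q _) => qt qf; lra.
Qed.

(** The mirror image: where a zero pays more, the expectation decreases in the probability of a one,
    and the inequality at [c] carries over to every [p >= c]. *)
Lemma downward_bets_bounded omega I c :
  computably_random (stationary I) omega ->
  (forall p, forecast_set I p -> c <= p) ->
  (forall s, c * Q (rcons s true) + (1 - c) * Q (rcons s false) <= Q s) ->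
  exists B, forall n, ratio_process R (bet_num (negb \o bets_upward))
    (bet_den (negb \o bets_upward)) (Defs.prefix_path omega n) <= B.
Proof.
move=> rnd Ic sub.
have rdown : recursive (fun n => (negb \o bets_upward) n : nat).
  have := recursive_sub (recursive_cst 1) recursive_bets_upward.
  by congr recursive; apply/funext => n /=; case: bets_upward.
have [rn rd] := recursive_bets rdown.
apply: (ratio_process_bounded rnd rn rd (bet_den_gt0 _)) => s p /Ic cp.
rewrite !bet_ratio /= bets_upwardE; case: (leP (Q _)) => [_|/= lt_tf]; first by rewrite /=; lra.
rewrite  (mulrA p) (mulrA (1 - p)) -mulrDl ler_pdivrMr // mul1r; apply: le_trans (sub s).
have : 0 <= (p - c) * (Q (rcons s false) - Q (rcons s true)).
  by rewrite mulr_ge0 ?subr_ge0 // ltW.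
by move: (Q (rcons s true)) (Q _) => qt qf; lra.
Qed.

End Splitting.

(** * Randomness for the intersection of two forecasts *)

Theorem proposition32 (R : realType) (omega : binary_path)
    (I J : interval_forecast R) :
  computably_random_forecasts omega I ->
  computably_random_forecasts omega J ->
  forecast_set I `&` forecast_set J !=set0 /\
  exists2 K : interval_forecast R,
    forecast_set K = forecast_set I `&` forecast_set J &
    computably_random_forecasts omega K.
Proof.
move=> rndI rndJ.
have [a [b [a0 ab b1 IE]]] := forecast_setP I.
have [a' [b' [a'0 ab' b1' JE]]] := forecast_setP J.
have geI p : forecast_set I p -> a <= p by rewrite IE /= in_itv /= => /andP[].
have leI p : forecast_set I p -> p <= b by rewrite IE /= in_itv /= => /andP[].
have geJ p : forecast_set J p -> a' <= p by rewrite JE /= in_itv /= => /andP[].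
have leJ p : forecast_set J p -> p <= b' by rewrite JE /= in_itv /= => /andP[].
(* Two intervals meet once neither lies wholly above the other; both orders are excluded by the
   separation lemma. *)
have ab'' : a' <= b.
  by apply: (forecasts_not_separated rndI rndJ) => //; [exact: le_trans ab|exact: le_trans b1'].
have a'b : a <= b'.
  by apply: (forecasts_not_separated rndJ rndI) => //; [exact: le_trans ab'|exact: le_trans b1].
pose c := Num.max a a'; pose d := Num.min b b'.
have cd : c <= d by rewrite ge_max !le_min ab ab' ab'' a'b.
have IJE : forecast_set I `&` forecast_set J = `[c, d]%classic.
  rewrite IE JE; apply/seteqP; split=> p; rewrite /= !in_itv /= ge_max le_min.
    by move=> [/andP[-> ->] /andP[-> ->]].
  by move=> /andP[/andP[-> ->] /andP[-> ->]].
have IJc : (forecast_set I `&` forecast_set J) c by rewrite IJE /= in_itv /= lexx cd.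
have IJd : (forecast_set I `&` forecast_set J) d by rewrite IJE /= in_itv /= lexx cd.
split; first by exists c.
have KP : exists p q : R, [/\ 0 <= p, p <= q, q <= 1 &
    forecast_set I `&` forecast_set J = `[p, q]%classic].
  by exists c, d; split; rewrite // ?le_max ?ge_min ?a0 ?b1.
exists (IntervalForecast KP) => // T cT superT.
have [A [rA A0 [TQ Qsuper]]] := nat_supermartingale cT superT.
have [B1 PB1] : exists B, forall n, ratio_process R (bet_num A (bets_upward A))
    (bet_den A (bets_upward A)) (Defs.prefix_path omega n) <= B.
  (* The upper end [d] belongs to [I] or to [J], and the randomness for that forecast bounds the
     upward bets; likewise below with the lower end [c]. *)
  have sub s := Qsuper s d IJd; have [db|db'] : d = b \/ d = b'.
  - by rewrite /d; case: leP; [left|right].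
  - by apply: (upward_bets_bounded rA A0 rndI _ sub) => p; rewrite db; exact: leI.
  - by apply: (upward_bets_bounded rA A0 rndJ _ sub) => p; rewrite db'; exact: leJ.
have [B2 PB2] : exists B, forall n, ratio_process R (bet_num A (negb \o bets_upward A))
    (bet_den A (negb \o bets_upward A)) (Defs.prefix_path omega n) <= B.
  have sub s := Qsuper s c IJc; have [ca|ca'] : c = a \/ c = a'.
  - by rewrite /c; case: leP; [right|left].
  - by apply: (downward_bets_bounded rA A0 rndI _ sub) => p; rewrite ca; exact: geI.
  - by apply: (downward_bets_bounded rA A0 rndJ _ sub) => p; rewrite ca'; exact: geJ.
(* [q] is the initial value of [Q]: along the path [T] is at most [Q], which is [q] times the
   product of the two bounded processes. *)
pose q : R := (A (code_situation [::]))%:R / 2 ^+ code_situation [::].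
have q0 : 0 < q by rewrite divr_gt0 ?exprn_gt0 // ltr0n.
apply: (@le_lt_trans _ _ (B1 * B2 * q)%:E); last exact: ltry.
apply: ge_ereal_sup => _ [n _ <-]; rewrite lee_fin; apply: le_trans (TQ _) _.
rewrite -ler_pdivrMr // -split_ratio_process //.
by apply: ler_pM => //; rewrite divr_ge0.
Qed.
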